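(* Let $G$ be a niche-realizable graph. Then every component of $G$ has a Hamilton path, and every component of $G$ that is $2$-connected is hamiltonian.
   Context: All graphs are simple. A bipartite tournament is an orientation of a complete bipartite graph. The niche graph of a digraph $D$ is the graph with vertex set $V(D)$ in which distinct $u,v$ are adjacent iff there is a vertex $w$ with $(u,w),(v,w)\in A(D)$, or with $(w,u),(w,v)\in A(D)$. A graph is niche-realizable if it is the niche graph of some bipartite tournament. *)

(* Defs.v *)
From mathcomp Require Import all_boot.

Set Implicit Arguments.
Unset Strict Implicit.
Unset Printing Implicit Defensive.

Record sgraph := SGraph {
  svertex :> finType;
  sedge : rel svertex;
  sedge_sym : symmetric sedge;
  sedge_irrefl : irreflexive sedge }.

Section Induced.
Variables (G : sgraph) (A : {set G}).

Definition induced_edge : rel {x : G | x \in A} :=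
  fun u v => sedge (val u) (val v).

Lemma induced_edge_sym : symmetric induced_edge.
Proof. by move=> u v; exact: sedge_sym. Qed.

Lemma induced_edge_irrefl : irreflexive induced_edge.
Proof. by move=> u; exact: sedge_irrefl. Qed.

Definition induced : sgraph := SGraph induced_edge_sym induced_edge_irrefl.
End Induced.

(* Vertex sets of the components; the component itself is [induced C]. *)
Definition components (G : sgraph) : {set {set G}} :=
  equivalence_partition (connect (@sedge G)) [set: G].

Definition connected (G : sgraph) : Prop :=
  0 < #|G| /\ forall u v : G, connect (@sedge G) u v.

Definition k_connected (k : nat) (G : sgraph) : Prop :=
  k < #|G| /\ forall S : {set G}, #|S| < k -> connected (induced (~: S)).

(* The path visits the vertices of [x :: p] in order; the one-vertex path is
   allowed. *)
Definition has_hamilton_path (G : sgraph) : Prop :=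
  exists (x : G) (p : seq G),
    [/\ path (@sedge G) x p, uniq (x :: p) & forall v : G, v \in x :: p].

(* [2 < size c] is needed because MathComp's [cycle] accepts the empty sequence
   and, for a symmetric relation, an edge traversed back and forth. *)
Definition hamiltonian (G : sgraph) : Prop :=
  exists c : seq G,
    [/\ 2 < size c, cycle (@sedge G) c, uniq c & forall v : G, v \in c].

(* Either part may be empty. *)
Definition complete_bipartite (G : sgraph) : Prop :=
  exists V1 : {set G},
    forall u v : G, sedge u v = ((u \in V1) != (v \in V1)).

(* A digraph on [T] is given by its arc relation. *)
Definition orientation (G : sgraph) (D : rel G) : Prop :=
  (forall u v : G, D u v -> sedge u v) /\
  (forall u v : G, sedge u v -> D u v (+) D v u).

Definition bipartite_tournament (T : finType) (D : rel T) : Prop :=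
  exists (e : rel T) (es : symmetric e) (ei : irreflexive e),
    complete_bipartite (SGraph es ei) /\ @orientation (SGraph es ei) D.

Section Niche.
Variables (T : finType) (D : rel T).

Definition niche_edge : rel T := fun u v =>
  (u != v) && [exists w, (D u w && D v w) || (D w u && D w v)].

Lemma niche_edge_sym : symmetric niche_edge.
Proof.
move=> u v; rewrite /niche_edge eq_sym; congr (_ && _).
by apply: eq_existsb => w; rewrite andbC [D w u && _]andbC.
Qed.

Lemma niche_edge_irrefl : irreflexive niche_edge.
Proof. by move=> u; rewrite /niche_edge eqxx. Qed.

Definition niche_graph : sgraph := SGraph niche_edge_sym niche_edge_irrefl.
End Niche.

Definition niche_realizable (G : sgraph) : Prop :=
  exists D : rel G,
    bipartite_tournament D /\ @sedge G =2 @sedge (niche_graph D).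

(* Main.v *)
Require Import Defs.
From mathcomp Require Import all_boot.

(** Two vertices on the same side of a bipartite tournament are non-adjacent in
    the niche graph iff their out-neighbourhoods are complementary.  Hence in a
    component [C] no three vertices are pairwise non-adjacent, and the
    complement of [C] has no induced path on four vertices.

    Hamilton path: if no vertex off a path is adjacent to one of its ends, these
    ends are adjacent, so the path closes up to a cycle; by connectedness some
    vertex off the cycle is adjacent to it, and opening the cycle there gives a
    longer path.

    Hamilton cycle: let [x ... y] be a Hamilton path with [x], [y] non-adjacent.
    If it has consecutive vertices [u], [v] with [u] adjacent to [y] and [v] to
    [x], then [x ... u y ... v x] is a Hamilton cycle.  Otherwise every vertex
    before the first neighbour [w] of [y] is non-adjacent to [y], and every
    vertex after [w] is non-adjacent to [x]; there is no edge between these two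
    sets, so [w] is a cut vertex. *)

Set Implicit Arguments.
Unset Strict Implicit.
Unset Printing Implicit Defensive.

Definition independence_le2 (G : sgraph) : Prop :=
  forall x y z : G, x != y -> y != z -> x != z ->
    [|| sedge x y, sedge y z | sedge x z].

(* The chords [x'x] and [yy'] of the complement path [x' y x y'] are not
   mentioned because [independence_le2] already excludes them. *)
Definition complement_P4_free (G : sgraph) : Prop :=
  forall x' y x y' : G, x' != y -> x != y -> x != y' ->
    ~~ sedge x' y -> ~~ sedge x y -> ~~ sedge x y' -> ~~ sedge x' y'.

(** * Reachability and path surgery *)

Lemma connect_closed (T : finType) (e : rel T) (P : pred T) (x y : T) :
  (forall u v, e u v -> P u -> P v) -> connect e x y -> P x -> P y.
Proof.
move=> clP /connectP[p + ->]; elim: p x => [|z p IHp] x //= /andP[exz ep] Px.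
exact: (IHp z ep (clP _ _ exz Px)).
Qed.

Lemma has_split_first (T : Type) (a : pred T) (s : seq T) : has a s ->
  exists s1 z s2, [/\ s = s1 ++ z :: s2, a z & ~~ has a s1].
Proof.
by case/split_find=> z s1 s2 az ns1; exists s1, z, s2; rewrite cat_rcons.
Qed.

(** Exchange of crossing chords: the path edge into [v] is dropped and the tail is traversed
    backwards. *)
Lemma cycle_cat_rev (T : Type) (e : rel T) (x v : T) (s t : seq T) :
  symmetric e -> path e x (s ++ v :: t) ->
  e (last x s) (last v t) -> e v x -> cycle e (x :: s ++ rev (v :: t)).
Proof.
move=> e_sym; rewrite cat_path /= => /and3P[es _ et] el evx.
rewrite rcons_cat cat_path es rcons_path rev_cons last_rcons evx andbT /=.
rewrite -rev_cons lastI rev_rcons /= el rev_path.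
by rewrite (eq_path (e' := e)) // => a b; rewrite e_sym.
Qed.

(** * Hamilton paths from independence number at most two *)

Section HamiltonPath.
Variable G : sgraph.
Hypothesis alphaG : independence_le2 G.
Hypothesis connG : forall u v : G, connect (@sedge G) u v.

Lemma longer_path (x : G) (p : seq G) :
  path (@sedge G) x p -> uniq (x :: p) -> size (x :: p) < #|G| ->
  exists (x' : G) (p' : seq G),
    [/\ path (@sedge G) x' p', uniq (x' :: p') & size p' = (size p).+1].
Proof.
move=> ep up lt_p.
have [v vNp] : exists v, v \notin x :: p.
  apply/existsP; rewrite -negb_forall; apply: contraL lt_p => /forallP p_all.
  rewrite -leqNgt -(card_uniqP up); apply/subset_leq_card/subsetP => z _.
  exact: p_all.
have [/existsP[w /andP[wNp ewx]] | noL] :=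
    boolP [exists w, (w \notin x :: p) && sedge w x].
  by exists w, (x :: p); split; rewrite //= ?ewx //; move: up => /= ->; rewrite wNp.
have [/existsP[w /andP[wNp ewy]] | noR] :=
    boolP [exists w, (w \notin x :: p) && sedge (last x p) w].
  exists x, (rcons p w); split; rewrite ?size_rcons ?rcons_path ?ep //.
  by rewrite -rcons_cons rcons_uniq wNp.
have nL w : w \notin x :: p -> ~~ sedge w x.
  by move=> wNp; move/existsPn/(_ w): noL; rewrite wNp.
have nR w : w \notin x :: p -> ~~ sedge (last x p) w.
  by move=> wNp; move/existsPn/(_ w): noR; rewrite wNp.
have [u [w [up' wNp euw]]] :
    exists u w, [/\ u \in x :: p, w \notin x :: p & sedge u w].
  have [/existsP[u /existsP[w /and3P[]]] | noE] :=
      boolP [exists u : G, [exists w : G,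
              [&& u \in x :: p, w \notin x :: p & sedge u w]]].
    by exists u, w.
  suff: v \in x :: p by rewrite (negbTE vNp).
  apply: (@connect_closed _ _ (mem (x :: p)) x v _ (connG x v)) (mem_head x p).
  move=> a b eab ap; apply: contraNT noE => bNp.
  by apply/existsP; exists a; apply/existsP; exists b; apply/and3P.
(* A vertex of the path other than [x] shows that the two ends differ, as [alphaG] requires. *)
have ux : u != x.
  by apply: contraTneq euw => ->; rewrite sedge_sym nL.
have xy : x != last x p.
  case/lastP: p up up' {ep lt_p vNp noL noR nL nR wNp} => [|q z].
    by rewrite inE (negPf ux).
  rewrite last_rcons /= => /andP[xNq _] _.
  by apply: contraNneq xNq => ->; rewrite mem_rcons mem_head.
have cyc : cycle (@sedge G) (x :: p).
  rewrite /= rcons_path ep /=.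
  have := @alphaG (last x p) x v _ _ _.
  rewrite eq_sym xy => /(_ isT).
  rewrite [sedge x v]sedge_sym (negPf (nL _ vNp)) (negPf (nR _ vNp)) !orbF; apply.
    by apply: contraNneq vNp => <-; rewrite mem_head.
  by apply: contraNneq vNp => <-; rewrite mem_last.
(* Rotate the cycle to start at [u], drop its closing edge and put [w] in front. *)
have [i s def_s] := rot_to up'.
exists w, (u :: s); split.
- rewrite /= sedge_sym euw; move: cyc; rewrite -(rot_cycle i) def_s /=.
  by rewrite rcons_path => /andP[].
- by rewrite cons_uniq -def_s mem_rot wNp rot_uniq.
- by rewrite -def_s size_rot.
Qed.

Lemma independence_le2_hamilton_path : 0 < #|G| -> has_hamilton_path G.
Proof.
move=> G_gt0.
have [x [p [ep up sz]]] : exists (x : G) (p : seq G),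
    [/\ path (@sedge G) x p, uniq (x :: p) & size p = #|G|.-1].
  (* By induction there is a path with [n] edges for every [n < #|G|]. *)
  have: #|G|.-1 < #|G| by rewrite prednK.
  elim: #|G|.-1 => [|n IHn] lt_n.
    by have /card_gt0P[x _] := G_gt0; exists x, [::].
  have [x [p [ep up sz]]] := IHn (ltnW lt_n).
  have [|x' [p' [? ? sz']]] := longer_path ep up; first by rewrite /= sz.
  by exists x', p'; rewrite sz' sz.
exists x, p; split=> // v.
have/subset_cardP: #|x :: p| = #|G| by rewrite (card_uniqP up) /= sz prednK.
by move=> /(_ (subset_predT _)) ->.
Qed.

End HamiltonPath.

(** * Hamilton cycles in 2-connected graphs *)

Section HamiltonCycle.
Variable G : sgraph.
Hypothesis alphaG : independence_le2 G.
Hypothesis P4G : complement_P4_free G.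

(** Deleting [w] is expressed by a relation on [G] itself, so that closed vertex sets of [G] can be
    tested against it without subtypes. *)
Lemma no_cut_vertex_connect (w x y : G) :
  k_connected 2 G -> x != w -> y != w ->
  connect (fun u v => [&& u != w, v != w & sedge u v]) x y.
Proof.
move=> [_ /(_ [set w])]; rewrite cards1 => /(_ isT)[_ connGw] xw yw.
have xP : x \in ~: [set w] by rewrite !inE.
have yP : y \in ~: [set w] by rewrite !inE.
apply: (connect_closed (e := @sedge (induced (~: [set w])))
  (P := fun u => connect _ x (val u)) _ (connGw (Sub x xP) (Sub y yP))) => //=.
move=> u v euv /connect_trans; apply; apply: connect1; apply/and3P; split=> //.
  by have := valP u; rewrite !inE.
by have := valP v; rewrite !inE.
Qed.

Lemma hamilton_path_hamiltonian :
  k_connected 2 G -> has_hamilton_path G -> hamiltonian G.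
Proof.
move=> kG [x [p [ep up p_all]]].
have szG : 2 < size (x :: p).
  rewrite -(card_uniqP up); apply: leq_trans (proj1 kG) _.
  by apply/subset_leq_card/subsetP => v _; apply: p_all.
set y := last x p.
have [eyx | nyx] := boolP (sedge y x).
  by exists (x :: p); split=> //=; rewrite rcons_path ep.
have nxy : ~~ sedge x y by rewrite sedge_sym.
have xy : x != y.
  rewrite /y; case/lastP: p up szG {ep p_all y nyx nxy} => [|q z] //.
  rewrite last_rcons /= => /andP[xNq _] _.
  by apply: contraNneq xNq => ->; rewrite mem_rcons mem_head.
have near_y v : v != x -> ~~ sedge x v -> v != y -> sedge v y.
  move=> vx nxv vy; have := @alphaG x v y.
  by rewrite eq_sym vx vy xy (negPf nxv) (negPf nxy) orbF; apply.
(* The predecessor of [y] on the path is a neighbour of [y]; it is not [x], so it lies in [p]. *)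
have hasp : has (fun v => sedge v y) p.
  move: xy nxy (ep); rewrite /y; case/lastP: p {ep up p_all szG y nyx near_y}.
    by rewrite /= eqxx.
  move=> q z; rewrite last_rcons rcons_path => _ nxz /andP[_ elz].
  apply/hasP; exists (last x q) => //.
  have := mem_last x q; rewrite inE => /orP[/eqP lx | ].
    by rewrite lx (negPf nxz) in elz.
  by rewrite mem_rcons inE => ->; rewrite orbT.
have [p1 [w [p2 [def_p ewy np1]]]] := has_split_first hasp.
(* Let [v] be the first neighbour of [x] after [w]. Its predecessor is [w], or a non-neighbour of
   [x], which [near_y] makes adjacent to [y]. *)
have [hasx | nhasx] := boolP (has (sedge x) p2).
  have [q1 [v [q2 [def_p2 exv nq1]]]] := has_split_first hasx.
  have dp : p = (p1 ++ w :: q1) ++ v :: q2 by rewrite def_p def_p2 -catA.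
  have yE : y = last v q2 by rewrite /y dp last_cat.
  exists (x :: (p1 ++ w :: q1) ++ rev (v :: q2)).
  have pe : perm_eq (x :: (p1 ++ w :: q1) ++ rev (v :: q2)) (x :: p).
    by rewrite perm_cons dp perm_cat2l perm_rev.
  rewrite (perm_size pe) (perm_uniq pe); split=> // [|z]; last first.
    by rewrite (perm_mem pe).
  apply: cycle_cat_rev;
    [exact: sedge_sym | by rewrite -dp | | by rewrite sedge_sym].
  rewrite -yE last_cat /=.
  have := mem_last w q1; rewrite inE => /orP[/eqP-> // | uq1].
  have uNt : last w q1 \notin v :: q2.
    move: up; rewrite cons_uniq dp cat_uniq => /and4P[_ _ /hasPn dis _].
    by apply/negP => /dis; rewrite /= mem_cat inE uq1 !orbT.
  apply: near_y.
  - move: up; rewrite cons_uniq dp => /andP[xNp _].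
    by apply: contraNneq xNp => <-; rewrite !mem_cat inE uq1 !orbT.
  - by apply: contraNN nq1 => exu; apply/hasP; exists (last w q1).
  - by apply: contraNneq uNt => ->; rewrite yE mem_last.
have nP1 v : v \in x :: p1 -> ~~ sedge v y.
  rewrite inE => /orP[/eqP->// | vp1].
  by apply: contraNN np1 => evy; apply/hasP; exists v.
have nP2 v : v \in p2 -> ~~ sedge x v.
  by move=> vp2; apply: contraNN nhasx => exv; apply/hasP; exists v.
have yw : y != w by apply: contraTneq ewy => ->; rewrite sedge_irrefl.
have wNp1 : w \notin x :: p1 by apply: contraTN ewy; apply: nP1.
have xw : x != w by apply: contraNneq wNp1 => <-; rewrite mem_head.
have yE : y = last w p2 by rewrite /y def_p last_cat.
have yp2 : y \in p2.
  by have := mem_last w p2; rewrite -yE inE (negPf yw).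
have dis v : v \in p2 -> v \notin x :: p1.
  move: up; rewrite def_p -cat_cons cat_uniq => /and3P[_ /hasPn d _] vp2.
  by apply: d; rewrite inE vp2 orbT.
have/negP[] := dis y yp2.
(* Edges avoiding [w] cannot leave [x :: p1]: an edge from [u] there to [v] in [p2] is ruled out by
   the complement path [u y x v]. *)
apply: (connect_closed (P := mem (x :: p1)) _ (no_cut_vertex_connect kG xw yw));
  last exact: mem_head.
move=> u v /and3P[_ vw euv] /= up1; have := p_all v.
rewrite def_p -cat_cons mem_cat => /orP[// | ].
rewrite inE (negPf vw) /= => vp2; apply: contraTT euv => _.
apply: (P4G (y := y) (x := x)) => //; rewrite ?nP1 ?nP2 //.
  by apply: contraNneq (dis y yp2) => <-.
by apply: contraNneq (dis v vp2) => <-; rewrite mem_head.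
Qed.

End HamiltonCycle.

(** * Components of niche graphs *)

Lemma niche_realizable_out_neighbours (G : sgraph) : niche_realizable G ->
  exists (V1 : {set G}) (D : rel G), forall u v : G, u != v ->
    sedge u v = ((u \in V1) == (v \in V1)) &&
      [exists w, ((u \in V1) != (w \in V1)) && (D u w == D v w)].
Proof.
move=> [D [[e [es [ei [[V1 eV1] [D_e e_D]]]]] sE]]; exists V1, D => u v uv.
have DV a b : D a b -> (a \in V1) != (b \in V1) by move=> /D_e; rewrite eV1.
(* Across the bipartition, in-neighbours are exactly the non-out-neighbours, so a common
   in-neighbour is also a [w] at which the two rows of [D] agree. *)
have VD a b : (a \in V1) != (b \in V1) -> D b a = ~~ D a b.
  by rewrite -eV1 => /e_D; case: (D a b) (D b a) => [] [].
rewrite sE /= /niche_edge uv /=; apply/existsP/andP.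
  case=> w /orP[] /andP[uw vw].
    have su := DV _ _ uw; have sv := DV _ _ vw; split.
      by move: su sv; do 3!case: (_ \in V1).
    by apply/existsP; exists w; rewrite su uw vw.
  have su := DV _ _ uw; have sv := DV _ _ vw; split.
    by move: su sv; do 3!case: (_ \in V1).
  apply/existsP; exists w.
  by rewrite eq_sym su (VD w u) // (VD w v) // uw vw.
case=> /eqP suv /existsP[w /andP[su /eqP Duv]]; exists w.
by rewrite !(VD _ w) -?suv // -Duv; case: (D u w).
Qed.

Section Component.
Variables (G : sgraph) (C : {set G}).
Hypothesis compC : C \in components G.

Let connect_equivalence :
  {in [set: G] & &, equivalence_rel (connect (@sedge G))}.
Proof.
move=> a b c _ _ _; split=> //.
by move/(same_connect (sym_connect_sym (@sedge_sym G))).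
Qed.

Lemma component_connect (x y : G) : x \in C ->
  (y \in C) = connect (@sedge G) x y.
Proof.
have part := equivalence_partitionP connect_equivalence => xC.
have -> : C = pblock (components G) x.
  by rewrite (def_pblock _ compC xC) //; case/and3P: part.
by rewrite (pblock_equivalence_partition connect_equivalence) ?inE.
Qed.

Lemma component_neq0 : 0 < #|induced C|.
Proof.
have /and3P[_ _ C0] := equivalence_partitionP connect_equivalence.
have /set0Pn[x xC] : C != set0 by apply: contraNneq C0 => <-.
by apply/card_gt0P; exists (Sub x xC).
Qed.

Lemma component_induced_connect (u v : induced C) :
  connect (@sedge (induced C)) u v.
Proof.
(* [P] spreads along edges of [G] because a neighbour of a vertex of [C] is in [C]. *)
pose P z := [exists t : induced C,
  (val t == z) && connect (@sedge (induced C)) u t].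
have /existsP[t /andP[/eqP/val_inj <-]//] : P (val v).
apply: (@connect_closed _ (@sedge G) P (val u)); last first.
- by apply/existsP; exists u; rewrite eqxx /=.
- by rewrite -component_connect; apply: valP.
move=> a b eab /existsP[t /andP[/eqP ta ut]].
have bC : b \in C by rewrite (component_connect b (valP t)) ta connect1.
apply/existsP; exists (Sub b bC); rewrite SubK eqxx /=.
by apply: connect_trans ut (connect1 _); rewrite /= /induced_edge SubK ta.
Qed.

Hypothesis nicheG : niche_realizable G.

(* [O] is the side of the bipartition that does not contain [C]. *)
Lemma component_opposite_side :
  exists (O : {set G}) (D : rel G),
    [/\ forall u v : induced C, u != v ->
          sedge u v = [exists w in O, D (val u) w == D (val v) w]
      & forall u v : induced C, u != v -> O != set0].
Proof.
have [V1 [D eD]] := niche_realizable_out_neighbours nicheG.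
have e_neq a b : @sedge G a b -> a != b.
  by apply: contraTneq => ->; rewrite sedge_irrefl.
have /card_gt0P[x0 _] := component_neq0.
(* Niche edges join vertices of the same side, so [C] lies on one side. *)
have sideC (u : induced C) : (val u \in V1) = (val x0 \in V1).
  have := component_connect (val u) (valP x0); rewrite (valP u) => /esym.
  move=> /(@connect_closed _ _ (fun a => (a \in V1) == (val x0 \in V1))).
  move=> cl; apply/eqP; apply: cl => // a b eab /eqP <-.
  by move: (eab); rewrite (eD _ _ (e_neq _ _ eab)) eq_sym => /andP[].
exists [set w | (val x0 \in V1) != (w \in V1)], D; split=> u v uv.
  rewrite /= /induced_edge eD // !sideC eqxx /=.
  by apply: eq_existsb => w; rewrite inE.
(* Two distinct vertices force an edge at [u], whose witness lies in [O]. *)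
have /connectP[[|z p] /=] := component_induced_connect u v.
  by move=> _ vu; rewrite vu eqxx in uv.
rewrite /induced_edge => /andP[euz _] _; move: (euz).
rewrite (eD _ _ (e_neq _ _ euz)) => /andP[_ /existsP[w /andP[]]].
by rewrite sideC => sw _; apply/set0Pn; exists w; rewrite inE.
Qed.

(** Pigeonhole: at a single [w] in [O], two of three vertices have the same value of [D _ w]. *)
Lemma component_independence_le2 : independence_le2 (induced C).
Proof.
have [O [D [eD O0]]] := component_opposite_side => x y z xy yz xz.
have /set0Pn[w wO] := O0 _ _ xy.
have ad (u v : induced C) : u != v -> D (val u) w == D (val v) w -> sedge u v.
  by move=> uv Duv; rewrite eD //; apply/exists_inP; exists w.
have := (ad _ _ xy, ad _ _ yz, ad _ _ xz).
by do 3![case: (D _ w)] => -[[exy eyz] exz]; apply/or3P;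
  solve [apply: Or31; exact: exy | apply: Or32; exact: eyz
        | apply: Or33; exact: exz].
Qed.

(** Non-adjacency flips [D _ w] at every [w] in [O]; three flips amount to one. *)
Lemma component_complement_P4_free : complement_P4_free (induced C).
Proof.
have [O [D [eD _]]] := component_opposite_side => x' y x y' x'y xy xy'.
have [-> _ _ _|x'y'] := eqVneq x' y'; first by rewrite sedge_irrefl.
rewrite !eD // => /exists_inPn h1 /exists_inPn h2 /exists_inPn h3.
apply/exists_inPn => w wO; move: (h1 w wO) (h2 w wO) (h3 w wO).
by case: (D _ w) (D _ w) (D _ w) (D _ w) => [] [] [] [].
Qed.

End Component.

Theorem theorem4p8 (G : sgraph) (hG : niche_realizable G) :
  (forall C : {set G}, C \in components G -> has_hamilton_path (induced C)) /\
  (forall C : {set G}, C \in components G ->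
     k_connected 2 (induced C) -> hamiltonian (induced C)).
Proof.
have hpath (C : {set G}) : C \in components G -> has_hamilton_path (induced C).
  move=> compC; apply: independence_le2_hamilton_path.
  - exact: component_independence_le2.
  - exact: component_induced_connect.
  - exact: component_neq0.
split=> // C compC kC; apply: hamilton_path_hamiltonian => //.
- exact: component_independence_le2.
- exact: component_complement_P4_free.
- exact: hpath.
Qed.
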